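(* Let $n\ge 7$ be an integer. Among all trees $T$ on $n$ vertices: (1) The path $P_n$ is the unique tree (up to isomorphism) maximizing $\operatorname{diam}(\mathcal{C}_3(T))$, and the maximum value is $\binom{\lceil n/2\rceil-1}{2}+\binom{\lfloor n/2\rfloor+2}{2}$. Equivalently: for every tree $T$ on $n\ge 7$ vertices, $\operatorname{diam}(\mathcal{C}_3(T))\le \binom{\lceil n/2\rceil-1}{2}+\binom{\lfloor n/2\rfloor+2}{2}$, with equality if and only if $T\cong P_n$. (2) The minimum value of $\operatorname{diam}(\mathcal{C}_3(T))$ is $\lfloor 3n/2\rfloor$, and the trees attaining it are exactly the star $K_{1,n-1}$ and the double stars $S(a,b)$ (with $a,b\ge 1$, $a+b+2=n$) satisfying $|a-b|\le 4$.
   Context: All trees are finite. A proper 3-coloring of a tree $T=(V,E)$ is a map $f\colon V\to\mathbb{Z}/3\mathbb{Z}$ with $f(u)\ne f(v)$ for every edge $uv\in E$. The 3-coloring graph $\mathcal{C}_3(T)$ is the graph whose vertices are the proper 3-colorings of $T$, two colorings being adjacent iff they differ at exactly one vertex; $\operatorname{diam}(\mathcal{C}_3(T))$ is its graph diameter. The double star $S(a,b)$ is the tree obtained by joining the centers of the stars $K_{1,a}$ and $K_{1,b}$ by an edge; it has $a+b+2$ vertices. *)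

(* Defs.v *)
From mathcomp Require Import all_boot.
Set Implicit Arguments. Unset Strict Implicit. Unset Printing Implicit Defensive.

Definition nedges n (e : rel 'I_n) : nat :=
  #|[set p : 'I_n * 'I_n | (p.1 < p.2) && e p.1 p.2]|.

Definition is_tree n (e : rel 'I_n) : Prop :=
  [/\ symmetric e, irreflexive e, (forall x y : 'I_n, connect e x y)
    & nedges e = n.-1].

Definition isomorphic n (e e' : rel 'I_n) : Prop :=
  exists f : 'I_n -> 'I_n, bijective f /\ forall u v, e' (f u) (f v) = e u v.

Definition coloring n := {ffun 'I_n -> 'I_3}.

Definition proper n (e : rel 'I_n) (f : coloring n) : bool :=
  [forall u, forall v, e u v ==> (f u != f v)].

Definition cadj n (e : rel 'I_n) (f g : coloring n) : bool :=
  [&& proper e f, proper e g & #|[set x | f x != g x]| == 1].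

Definition cstep n (e : rel 'I_n) (A : {set coloring n}) : {set coloring n} :=
  A :|: [set g | [exists f in A, cadj e f g]].

Definition cball n (e : rel 'I_n) (k : nat) (f : coloring n) : {set coloring n} :=
  iter k (cstep e) [set f].

(* Graph distance in C_3(T): least k with g in the k-ball of f.  Any shortest
   walk has length < #|coloring n|, so if g is not reachable the value
   #|coloring n| acts as "infinity" (this never happens for trees). *)
Definition cdist n (e : rel 'I_n) (f g : coloring n) : nat :=
  find (fun k => g \in cball e k f) (iota 0 #|{: coloring n}|).

Definition cdiam n (e : rel 'I_n) : nat :=
  \max_(f : coloring n | proper e f) \max_(g : coloring n | proper e g) cdist e f g.

Definition path_rel n : rel 'I_n :=
  fun u v => (u.+1 == v :> nat) || (v.+1 == u :> nat).

Definition star_rel n : rel 'I_n :=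
  fun u v => ((u == 0 :> nat) && (v != 0 :> nat)) || ((v == 0 :> nat) && (u != 0 :> nat)).

(* The double star S(a, n-2-a): centers 0 and 1, leaves 2..a+1 attached to 0,
   leaves a+2..n-1 attached to 1. *)
Definition dstar_adj (a u v : nat) : bool :=
  [|| (u == 0) && (v == 1),
      (u == 0) && (2 <= v <= a.+1)
    | (u == 1) && (a.+2 <= v)].

Definition dstar_rel n (a : nat) : rel 'I_n :=
  fun u v => dstar_adj a u v || dstar_adj a v u.

Definition max_bound (n : nat) : nat := 'C((uphalf n).-1, 2) + 'C(n./2 + 2, 2).

Arguments path_rel n : clear implicits.
Arguments star_rel n : clear implicits.
Arguments dstar_rel n a : clear implicits.

(* Main.v *)
From mathcomp Require Import all_boot all_order all_algebra perm zify.
Require Import Defs.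
Set Implicit Arguments. Unset Strict Implicit. Unset Printing Implicit Defensive.
Import Order.TTheory GRing.Theory.

(**
A proper 3-coloring of a tree lifts to an integer height function with steps +1 or -1 along the
edges, unique up to adding a multiple of 3, and a recoloring moves one local extremum by 2.  Hence
the distance of two colorings is the minimum over [k] of [dev D (3 * k)], the sum of [|D v - 3 k|],
where [D] is half the difference of two lifts of equal parity; every 1-Lipschitz [D] occurs.

Maximum: the values of [D] form an interval of integers.  Take [3 k] at distance at most 1 from a
median of [D]; the terms above and below [3 k] are bounded by those of an injective [D], and an
injective 1-Lipschitz [D] exists only on a path.

Minimum: any [D] with values 1 and 2 is 1-Lipschitz, which gives the lower bound.  It is exceeded
as soon as some 1-Lipschitz [h] with values in [-3, 3] takes both signs and has a sum of [|h v|]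
above [3 n / 2].  With [h] the signed distance to a non-leaf [u], truncated at 3, this works for
one of any two non-leaves with a common neighbor, since their two sums add up to at least
[4 n - 6].  Trees without two such non-leaves are stars and double stars.
*)

(** * Rooting a tree *)

(** Edges are exactly the pairs of a non-root vertex and its parent, so a property of all edges need
    only be checked at [v] and [p v]. The value [p r] is arbitrary. *)
Definition rooted n (e : rel 'I_n) (r : 'I_n) (d : 'I_n -> nat) (p : 'I_n -> 'I_n) : Prop :=
  [/\ d r = 0, (forall v, v != r -> d v = (d (p v)).+1)
    & forall u v, e u v = ((u != r) && (p u == v)) || ((v != r) && (p v == u))].

Section Rooted.
Variables (n : nat) (e : rel 'I_n) (r : 'I_n) (d : 'I_n -> nat) (p : 'I_n -> 'I_n).
Hypothesis rt : rooted e r d p.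

Lemma rooted_ind (P : 'I_n -> Prop) :
  P r -> (forall v, v != r -> P (p v) -> P v) -> forall v, P v.
Proof.
move=> Pr Ps v; have [k] := ubnP (d v); elim: k v => // k IH v dv.
have [->//|nvr] := eqVneq v r; apply: Ps => //; apply: IH.
by case: rt => _ /(_ v nvr) E _; lia.
Qed.

(** The depth [d v] is the fuel: it drops by one at each parent, so it lasts until the root. *)
Lemma rooted_rec (A : Type) (a : A) (s : 'I_n -> A -> A) :
  exists F : 'I_n -> A, F r = a /\ forall v, v != r -> F v = s v (F (p v)).
Proof.
pose fix rec k v {struct k} := if v == r then a else if k is k'.+1 then s v (rec k' (p v)) else a.
exists (fun v => rec (d v) v); split; first by case: (d r) => /=; rewrite eqxx.
by move=> v nvr; case: rt => _ /(_ v nvr) -> _ /=; rewrite (negbTE nvr).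
Qed.

Lemma rooted_depth0 v : (d v == 0) = (v == r).
Proof.
case: rt => d0 ds _; have [->|nvr] := eqVneq v r; first by rewrite d0.
by rewrite ds.
Qed.

Lemma rooted_parent v : v != r -> e v (p v).
Proof. by case: rt => _ _ -> ->; rewrite eqxx. Qed.

Lemma rooted_depth1 v : e r v = (d v == 1).
Proof.
case: rt => d0 ds ->; rewrite eqxx /=.
have [->|nvr] := eqVneq v r; first by rewrite d0.
by rewrite ds // eqSS rooted_depth0.
Qed.

Lemma rooted_edge_depth u v : e u v -> d u = (d v).+1 \/ d v = (d u).+1.
Proof.
by case: rt => d0 ds ->; case/orP => /andP[/ds -> /eqP ->]; [left|right].
Qed.

Lemma rooted_edge_up u v : e u v -> d u = (d v).+1 -> u != r /\ p u = v.
Proof.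
case: rt => d0 ds ->; case/orP => /andP[h /eqP E]; first by [].
by move: (ds _ h); rewrite E; lia.
Qed.

End Rooted.

Section TreeRoot.
Variables (n : nat) (e : rel 'I_n).
Hypothesis tr : is_tree e.

(** Take for [d] the length of a shortest walk from [r] and for [p v] a neighbor one step closer.
    The n - 1 edges from [v] to [p v] are pairwise distinct, and there are only n - 1 edges in
    all. *)
Lemma tree_root (r : 'I_n) : exists d p, rooted e r d p.
Proof.
case: tr => sym irr conn ne.
pose P v k := [exists t : k.-tuple 'I_n, path e r t && (last r t == v)].
have exP v : exists k, P v k.
  have /connectP[s ps ->] := conn r v.
  by exists (size s); apply/existsP; exists (in_tuple s); rewrite /= ps eqxx.
pose d v := ex_minn (exP v).
have dP v : P v (d v) by rewrite /d; case: ex_minnP.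
have dmin v k : P v k -> d v <= k by rewrite /d; case: ex_minnP => m _ H /H.
have dstep u v : e u v -> d v <= (d u).+1.
  move=> euv; apply: dmin; case/existsP: (dP u) => t /andP[pt /eqP lt].
  by apply/existsP; exists [tuple of rcons t v]; rewrite /= rcons_path last_rcons pt lt euv eqxx.
have d0 : d r = 0.
  by apply/eqP; rewrite -leqn0; apply: dmin; apply/existsP; exists [tuple]; rewrite /= eqxx.
have dpar v : v != r -> exists u, e v u && (d v == (d u).+1).
  move=> nvr; case/existsP: (dP v) => -[t /= /eqP st] /andP[pt /eqP lt].
  case/lastP: t => [|s x] in st pt lt *; first by rewrite -lt eqxx in nvr.
  move: lt pt st; rewrite last_rcons => ->; rewrite rcons_path size_rcons.
  move=> /andP[ps ex] st; exists (last r s); rewrite sym ex /=.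
  have le1 : d (last r s) <= size s.
    by apply: dmin; apply/existsP; exists (in_tuple s); rewrite /= ps eqxx.
  by rewrite eqn_leq dstep //= -st ltnS.
pose p v := if [pick u | e v u && (d v == (d u).+1)] is Some u then u else v.
have pP v : v != r -> e v (p v) /\ d v = (d (p v)).+1.
  rewrite /p => nvr; case: pickP => [u /andP[-> /eqP ->]//|H].
  by have [u] := dpar v nvr; rewrite H.
exists d, p; split=> // [v /pP[]//|u v].
apply/idP/idP; last first.
  by case/orP=> /andP[/pP[h _] /eqP <-]; rewrite // sym.
pose o (x y : 'I_n) := if x < y then (x, y) else (y, x).
pose E := [set q : 'I_n * 'I_n | (q.1 < q.2) && e q.1 q.2].
have oE x y : e x y -> o x y \in E.
  move=> exy; rewrite inE /o; case: (ltnP x y) => /= [->//|]; rewrite sym exy andbT.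
  rewrite leq_eqVlt => /orP[/eqP/val_inj H|->//].
  by rewrite H irr in exy.
have oinj x y x' y' : o x y = o x' y' -> (x = x' /\ y = y') \/ (x = y' /\ y = x').
  by rewrite /o; case: ifP => _; case: ifP => _ [-> ->]; auto.
have inj : {in [set~ r] &, injective (fun w => o w (p w))}.
  move=> x y; rewrite !inE => /pP[_ dx] /pP[_ dy] /oinj[[]//|[xE yE]].
  by move: dx dy; rewrite yE -xE => -> /eqP; rewrite -addn2 -[X in X == _]addn0 eqn_add2l.
have sub : [set o w (p w) | w in [set~ r]] \subset E.
  by apply/subsetP => q /imsetP[w]; rewrite in_setC1 => /pP[h _] ->; apply: oE.
have /eqP EE : [set o w (p w) | w in [set~ r]] == E.
  rewrite eqEcard sub card_in_imset // cardsC1 card_ord.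
  by rewrite -ne /=.
move=> euv; have := oE _ _ euv; rewrite -EE => /imsetP[w].
rewrite !inE => nw /oinj[[-> ->]|[-> ->]]; by rewrite nw eqxx ?orbT.
Qed.

End TreeRoot.

Lemma tree_ind n (e : rel 'I_n) (P : 'I_n -> Prop) r : is_tree e -> P r ->
  (forall u v, e u v -> P u -> P v) -> forall v, P v.
Proof.
move=> tr Pr H; have [d [p rt]] := tree_root tr r; apply: (rooted_ind rt) => // v nvr.
by apply: H; case: tr => sym _ _ _; rewrite sym; apply: (rooted_parent rt).
Qed.

(** * Heights and the diameter *)

Local Open Scope ring_scope.

Definition height n (e : rel 'I_n) (F : 'I_n -> int) : Prop :=
  forall u v, e u v -> `|F u - F v|%N = 1%N.

Definition lipschitz n (e : rel 'I_n) (D : 'I_n -> int) : Prop :=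
  forall u v, e u v -> (`|D u - D v| <= 1)%N.

Definition lifts n (f : coloring n) (F : 'I_n -> int) : Prop :=
  forall v, (F v %% 3)%Z = (f v : nat).

Definition dev n (D : 'I_n -> int) (t : int) : nat := (\sum_v `|D v - t|)%N.

Lemma sum_update n (h h' : 'I_n -> nat) v :
  (forall i, i != v -> h' i = h i) -> (\sum_i h' i + h v = \sum_i h i + h' v)%N.
Proof.
move=> H; rewrite (bigD1 v) // [in RHS](bigD1 v) //=.
by rewrite (eq_bigr h) => [|i /H//]; lia.
Qed.

(** * Walks of colorings as moves of height functions *)

Section Heights.
Variables (n : nat) (e : rel 'I_n).
Hypothesis sym : symmetric e.
Implicit Types (f g : coloring n) (F G D : 'I_n -> int).

Definition color (F : 'I_n -> int) : coloring n := [ffun v => inord `|(F v %% 3)%Z|%N].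

Lemma lifts_color F : lifts (color F) F.
Proof. by move=> v; rewrite ffunE inordK; lia. Qed.

Lemma lifts_inj f g F : lifts f F -> lifts g F -> f = g.
Proof.
move=> fF gF; apply/ffunP => v; apply: val_inj => /=.
by move: (fF v) (gF v) => -> [].
Qed.

Lemma height_proper f F : height e F -> lifts f F -> proper e f.
Proof.
move=> hF fF; apply/forallP => u; apply/forallP => v; apply/implyP => euv.
apply/eqP => fuv; move: (hF _ _ euv) (fF u) (fF v); rewrite fuv; lia.
Qed.

(** Induction on [N], undoing the last recoloring. Among the vertices where [D] has a fixed sign
    [s], one that minimizes [s * G] is a local extremum of [G]; moving [G] there by [2 * s] towards
    [F] gives a height again and lowers the sum by one. *)
Lemma cball_heights N f g F G D : height e F -> height e G -> lifts f F -> lifts g G ->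
  (forall v, F v = G v + 2 * D v) -> (\sum_v `|D v|)%N = N -> g \in cball e N f.
Proof.
elim: N g G D => [|N IH] g G D hF hG fF gG FG sumD.
  rewrite inE; apply/eqP; apply: lifts_inj fF => v; rewrite FG.
  move/eqP: sumD; rewrite sum_nat_eq0 => /forallP /(_ v) /eqP Dv.
  by rewrite (_ : D v = 0); [rewrite mulr0 addr0 gG | lia].
have [v0 Dv0] : exists v0, D v0 != 0.
  apply/existsP; apply: contra_eqT sumD; rewrite negb_exists => /forallP H.
  by rewrite big1 // => v _; move: (H v); rewrite negbK => /eqP ->.
pose s : int := if 0 < D v0 then 1 else -1.
have sE : s = 1 \/ s = -1 by rewrite /s; case: ifP; auto.
have sv0 : 0 < s * D v0 by rewrite /s; case: ifP; lia.
case: (@arg_minP _ int _ v0 (fun v => 0 < s * D v) (fun v => s * G v) sv0) => v sv vmin.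
(* A neighbor with [s * D u > 0] is controlled by minimality, any other one because [F] too changes
   by only 1 along the edge. *)
have {vmin} vmin u : e v u -> G u = G v + s.
  move=> evu; have := hG _ _ evu; have := hF _ _ evu; rewrite !FG.
  have := vmin u; case: ltP => [_ /(_ isT)|+ _]; case: sE sv => -> //; lia.
pose G' u := G u + (if u == v then 2 * s else 0).
pose D' u := D u - (if u == v then s else 0).
have cG' : forall u, u != v -> color G' u = g u.
  move=> u nuv; apply: val_inj => /=; have := lifts_color G' u; have := gG u.
  by rewrite {1}/G' (negbTE nuv) addr0 => -> [].
have eirr : ~~ e v v by apply/negP => /hG; lia.
have hG' : height e G'.
  move=> x y exy; have := hG _ _ exy; rewrite /G'.
  case: (eqVneq x v) => [xv|nx]; case: (eqVneq y v) => [yv|ny].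
  - by move: exy; rewrite xv yv (negbTE eirr).
  - by have := vmin y; rewrite -xv => /(_ exy) ->; case: sE => ->; lia.
  - by have := vmin x; rewrite -yv sym => /(_ exy) ->; case: sE => ->; lia.
  - by rewrite !addr0.
rewrite /cball iterS -/(cball e N f) inE; apply/orP; right; rewrite inE.
apply/existsP; exists (color G'); apply/andP; split.
  apply: (IH _ G' D') => // [|u|].
  - exact: lifts_color.
  - by rewrite /G' /D' FG; case: eqP; lia.
  - have H i : i != v -> `|D' i|%N = `|D i|%N by move=> /negbTE nv; rewrite /D' nv subr0.
    have := sum_update H; rewrite sumD /D' eqxx; case: sE sv => ->; lia.
rewrite /cadj (height_proper hG' (lifts_color _)) (height_proper hG gG) /=.
rewrite (_ : [set x | _] = [set v]) ?cards1 //; apply/setP => x; rewrite !inE.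
case: (eqVneq x v) => [->|/cG' ->]; last by rewrite eqxx.
apply/eqP => E; have := lifts_color G' v; have := gG v; rewrite E /G' eqxx.
by case: sE => ->; lia.
Qed.

(** In the other direction, the lift follows a walk: each recoloring changes it by 2 or -2 at a
    single vertex. *)
Lemma cball_lift k f g F : height e F -> lifts f F -> g \in cball e k f ->
  exists D, [/\ height e (fun v => F v - 2 * D v), lifts g (fun v => F v - 2 * D v)
              & (\sum_v `|D v| <= k)%N].
Proof.
move=> hF fF; elim: k g => [|k IH] g.
  rewrite inE => /eqP ->; exists (fun=> 0); split; last by rewrite big1.
    by move=> u v /hF; rewrite !mulr0 !subr0.
  by move=> v; rewrite mulr0 subr0.
rewrite /cball iterS -/(cball e k f) inE => /orP[/IH[D [? ? le]]|].
  by exists D; split=> //; apply: leqW.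
rewrite inE => /existsP[g0 /andP[/IH[D [hG gG le]]]].
case/and3P=> pg0 pg /cards1P[x xE].
have g0x : g0 x != g x by move/setP/(_ x): xE; rewrite !inE eqxx.
have g0E y : y != x -> g0 y = g y.
  by move=> nyx; apply/eqP; move/setP/(_ y): xE; rewrite !inE (negbTE nyx) => /negbFE.
pose G v : int := F v - 2 * D v.
(* Modulo 3 the two other colors at [x] are [G x + 2] and [G x - 2]. *)
pose s : int := if ((G x + 2) %% 3)%Z == (g x : nat) then 1 else -1.
have sE : s = 1 \/ s = -1 by rewrite /s; case: ifP; auto.
have gx : ((G x + 2 * s) %% 3)%Z = (g x : nat).
  have ng : nat_of_ord (g0 x) <> g x by move=> /val_inj/eqP; apply/negP.
  have [[-> //]|[]] : s = 1 /\ ((G x + 2 * 1) %% 3)%Z = (g x : nat)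
      \/ s = -1 /\ ((G x + 2) %% 3)%Z <> (g x : nat).
    by rewrite /s; case: eqP; [left|right].
  have := gG x; rewrite -/(G x); move: ng (ltn_ord (g x)) (ltn_ord (g0 x)).
  by move: (s) (G x) (nat_of_ord (g x)) (nat_of_ord (g0 x)) => s' a b c; lia.
(* A neighbor of [x] avoids both the old and the new color of [x], so it has the third one, which is
   [G x + s] modulo 3. *)
have nb y : e x y -> G y = G x + s.
  move=> exy; have nyx : y != x by apply/eqP => E; move: (hG _ _ exy); rewrite E; lia.
  have := hG _ _ exy; have := gG x; have := gG y; rewrite -/(G x) -/(G y).
  have : nat_of_ord (g0 x) <> g0 y.
    move=> /val_inj E; move/forallP/(_ x)/forallP/(_ y): pg0.
    by rewrite exy E eqxx.
  have : nat_of_ord (g x) <> g0 y.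
    move=> /val_inj; rewrite g0E // => E; move/forallP/(_ x)/forallP/(_ y): pg.
    by rewrite exy E eqxx.
  move: gx (ltn_ord (g x)) sE (ltn_ord (g0 x)) (ltn_ord (g0 y)).
  move: (s) (G x) (G y) (nat_of_ord (g x)) (nat_of_ord (g0 x)) (nat_of_ord (g0 y)).
  by move=> s' a a' b c c'; lia.
have eirr : ~~ e x x by apply/negP => /hG; lia.
exists (fun v => D v - (if v == x then s else 0)); split.
- move=> u v euv; have := hG _ _ euv; rewrite -/(G u) -/(G v).
  case: (eqVneq u x) => [ux|nu]; case: (eqVneq v x) => [vx|nv].
  + by move: euv; rewrite ux vx (negbTE eirr).
  + by have := nb v; rewrite -ux => /(_ euv); rewrite /G; case: sE => ->; lia.
  + by have := nb u; rewrite -vx sym => /(_ euv); rewrite /G; case: sE => ->; lia.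
  + by rewrite !subr0.
- move=> v; case: eqVneq => [->|nv]; last by rewrite subr0 gG g0E.
  by rewrite -gx /G; congr (_ %% _)%Z; lia.
- have H i : i != x -> `|D i - (if i == x then s else 0)|%N = `|D i|%N.
    by move=> /negbTE ->; rewrite subr0.
  have le2 : (`|D x - s| <= `|D x| + 1)%N by case: sE => ->; lia.
  rewrite -(leq_add2r `|D x|) (sum_update H) eqxx.
  by apply: leq_trans (leq_add le le2) _; lia.
Qed.

End Heights.

(** * The diameter in terms of 1-Lipschitz functions *)

Section Diameter.
Variables (n : nat) (e : rel 'I_n).
Hypothesis tr : is_tree e.
Implicit Types (f g : coloring n) (F G D : 'I_n -> int).

Lemma height_lift (r : 'I_n) f : proper e f -> exists F, height e F /\ lifts f F.
Proof.
move=> pf; have [d [p rt]] := tree_root tr r.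
pose s v (x : int) : int := if ((f (p v)).+1 %% 3 == f v)%N then x + 1 else x - 1.
have [F [Fr Fs]] := rooted_rec rt (f r : nat)%:Z s.
have fF : lifts f F.
  apply: (rooted_ind rt) => [|v nvr]; first by rewrite Fr modz_small; have := ltn_ord (f r); lia.
  have fvp : nat_of_ord (f v) <> f (p v).
    move=> /val_inj E; move/forallP/(_ v)/forallP/(_ (p v)): pf.
    by rewrite E eqxx (rooted_parent rt).
  rewrite (Fs v nvr) /s; move: fvp (ltn_ord (f v)) (ltn_ord (f (p v))).
  move: (F (p v)) (nat_of_ord (f v)) (nat_of_ord (f (p v))) => a b c.
  by case: eqP; lia.
exists F; split=> // u v; case: rt => _ _ -> /orP[]/andP[nr /eqP <-].
  by rewrite (Fs _ nr) /s; case: ifP; lia.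
by rewrite (Fs _ nr) /s; case: ifP; lia.
Qed.

Lemma height_parity (r : 'I_n) F G : height e F -> height e G ->
  (2 %| F r - G r)%Z -> forall v, (2 %| F v - G v)%Z.
Proof.
by move=> hF hG Pr; apply: (tree_ind tr Pr) => u v euv; have := hF _ _ euv; have := hG _ _ euv; lia.
Qed.

(** Adding [6 * k] to a lift of [g] gives a lift of the same parity and replaces [D] by [D - 3 * k],
    so [cball_heights] puts [g] in the ball of radius [dev D (3 * k)]. *)
Lemma cdiam_le M :
  (forall D, lipschitz e D -> exists k : int, (dev D (3 * k) <= M)%N) -> (cdiam e <= M)%N.
Proof.
move=> H; apply/bigmax_leqP => f pf; apply/bigmax_leqP => g pg.
case: (posnP n) => [n0|n_gt0].
  have -> : f = g by apply/ffunP => v; have := ltn_ord v; rewrite {2}n0.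
  rewrite /cdist; case: #|_| => //= k; by rewrite inE eqxx.
pose r : 'I_n := Ordinal n_gt0.
have [F [hF fF]] := height_lift r pf; have [G0 [hG0 gG0]] := height_lift r pg.
have [G [hG gG FG]] : exists G, [/\ height e G, lifts g G & (2 %| F r - G r)%Z].
  case: (boolP (2 %| F r - G0 r)%Z) => ev; first by exists G0.
  (* Adding 3 keeps the colors and switches the parity. *)
  exists (fun v => G0 v + 3); split; last by lia.
    by move=> u v /hG0; lia.
  by move=> v; rewrite -gG0 modzDr.
have {FG} FG := height_parity hF hG FG.
pose D v := ((F v - G v) %/ 2)%Z.
have FD v : F v = G v + 2 * D v by have := FG v; rewrite /D; lia.
have [|k dk] := H D.
  by move=> u v euv; have := hF _ _ euv; have := hG _ _ euv; have := FD u; have := FD v; lia.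
apply: leq_trans dk; set N := dev _ _.
have : g \in cball e N f.
  apply: (@cball_heights _ _ _ N f g F (fun v => G v + 6 * k) (fun v => D v - 3 * k)) => //.
  - by case: tr.
  - by move=> u v /hG; lia.
  - by move=> v; have := gG v; lia.
  - by move=> v; rewrite FD; lia.
rewrite /cdist; set m := #|_| => gN.
case: (leqP m N) => [le|lt].
  by apply: leq_trans le; rewrite -[X in (_ <= X)%N](size_iota 0); apply: find_size.
rewrite leqNgt; apply/negP => /(before_find 0%N).
by rewrite nth_iota // gN.
Qed.

(** The step of a lift along an edge is 1 or -1, and the two colors decide which. *)
Lemma height_unique (r : 'I_n) g G G' : height e G -> height e G' -> lifts g G -> lifts g G' ->
  forall v, G' v - G v = G' r - G r.
Proof.
move=> hG hG' gG gG'; apply: (tree_ind tr (r := r)) => // u v euv <-.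
have := hG _ _ euv; have := hG' _ _ euv; move: (gG u) (gG v) (gG' u) (gG' v).
by move=> <- <-; lia.
Qed.

(** Two heights [F] and [G = F - 2 D] realize [D]. A shorter walk would lift to some [D'] equal to
    [D - 3 * j], whose sum is [dev D (3 * j)]. There are [3 ^ n] colorings, and [cdist] returns this
    number when its search fails; hence a distance below [M] comes from a real walk. *)
Lemma cdiam_ge M D : (0 < n)%N -> lipschitz e D -> (forall k : int, (M <= dev D (3 * k))%N) ->
  (M <= 3 ^ n)%N -> (M <= cdiam e)%N.
Proof.
move=> n_gt0 lD HD M3; pose r : 'I_n := Ordinal n_gt0.
have [d [p rt]] := tree_root tr r.
(* [F] falls where [D] falls and rises elsewhere, which makes every step of [G] equal to 1 or -1. *)
pose s v (x : int) : int := if D (p v) <= D v then x + 1 else x - 1.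
have [F [Fr Fs]] := rooted_rec rt (0 : int) s.
pose G v := F v - 2 * D v.
have hFG v : v != r -> `|F v - F (p v)|%N = 1%N /\ `|G v - G (p v)|%N = 1%N.
  move=> nvr; have := lD _ _ (rooted_parent rt nvr); rewrite /G (Fs v nvr) /s.
  by case: ifP => /=; lia.
have hF : height e F.
  by move=> u v; case: rt => _ _ -> /orP[]/andP[/hFG[H _] /eqP <-]; lia.
have hG : height e G.
  by move=> u v; case: rt => _ _ -> /orP[]/andP[/hFG[_ H] /eqP <-]; lia.
have pF := height_proper hF (lifts_color F); have pG := height_proper hG (lifts_color G).
apply: leq_trans (leq_trans (leq_bigmax_cond _ pG) (leq_bigmax_cond _ pF)) => /=.
rewrite /cdist leqNgt; apply/negP; set P := (X in find X _) => lt.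
have sz : size (iota 0 #|{: coloring n}|) = (3 ^ n)%N.
  by rewrite size_iota card_ffun !card_ord.
have hP : has P (iota 0 #|{: coloring n}|) by rewrite has_find sz (leq_trans lt).
have := nth_find 0%N hP; set k := find _ _ in lt *.
rewrite nth_iota; last by rewrite -[X in (_ < X)%N](size_iota 0) -has_find.
rewrite add0n /P => /(cball_lift (let: And4 h _ _ _ := tr in h) hF (lifts_color F)).
case=> D' [hG' gG' le].
have G'E := height_unique r hG hG' (lifts_color G) gG'.
have [j jE] : exists j : int, D r - D' r = 3 * j.
  have := gG' r; rewrite -(lifts_color G r) /G => E.
  by exists ((D r - D' r) %/ 3)%Z; lia.
have := HD j; rewrite /dev leqNgt; case/negP; apply: leq_ltn_trans lt.
apply: leq_trans le; apply: leq_sum => v _.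
by have := G'E v; rewrite /G; lia.
Qed.

End Diameter.

(** * The minimum *)

Lemma sum_ltn n k : (\sum_(i < n) (i < k : nat) = minn k n)%N.
Proof.
elim: n => [|n IH]; first by rewrite big_ord0 minn0.
by rewrite big_ord_recr /= IH; lia.
Qed.

Lemma sum_eq1 n (u : 'I_n) : (\sum_v (v == u : nat) = 1)%N.
Proof. by rewrite (bigD1 u) //= eqxx big1 // => v /negbTE ->. Qed.

Lemma exp3_ge n : (3 * n <= 3 ^ n)%N.
Proof. by case: n => // n; rewrite expnS leq_mul2l /=; apply: ltn_expl. Qed.

Section Minimum.
Variables (n : nat) (e : rel 'I_n).
Hypotheses (n_gt0 : (0 < n)%N) (tr : is_tree e).
Implicit Types (D h : 'I_n -> int).

(** [D] is 2 on [n./2] arbitrary vertices and 1 on the others. The best multiples of 3 are 0 and 3,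
    with deviations n + floor(n/2) and n + ceil(n/2). *)
Lemma cdiam_lower : ((3 * n)./2 <= cdiam e)%N.
Proof.
pose b (v : 'I_n) : nat := (v < n./2)%N.
have sb : (\sum_v b v = n./2)%N by rewrite sum_ltn; lia.
have sc (c : nat) : (\sum_(v < n) c = c * n)%N by rewrite sum_nat_const card_ord mulnC.
apply: (cdiam_ge tr (D := fun v => 1 + (b v)%:Z)) => //.
- by move=> u v _; rewrite /b; lia.
- move=> k; case: (leP k 0) => hk.
    apply: (@leq_trans (\sum_v (1 + b v))%N); first by rewrite big_split /= sb sc; lia.
    by apply: leq_sum => v _; lia.
  apply: (@leq_trans (\sum_v (2 - b v))%N); last by apply: leq_sum => v _; rewrite /b; lia.
  have : (\sum_v (2 - b v) + \sum_v b v = 2 * n)%N.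
    by rewrite -big_split /= -sc; apply: eq_bigr => v _; rewrite /b; lia.
  by rewrite sb; lia.
- by apply: leq_trans (exp3_ge n); lia.
Qed.

(** The exact sum serves twice: it is large enough for k = 0, and small enough to force large
    deviations from 3 and -3. Other multiples of 3 are no closer, as [h] stays in [-3, 3]. *)
Lemma cdiam_mixed_eq h x y : lipschitz e h -> (forall v, `|h v| <= 3)%N -> 0 < h x -> h y < 0 ->
  (\sum_v `|h v| = (3 * n)./2.+1)%N -> ((3 * n)./2 < cdiam e)%N.
Proof.
move=> lh h3 hx hy sh; apply: (cdiam_ge tr (D := h)) => //; last first.
  by apply: leq_trans (exp3_ge n); lia.
have sc (c : nat) : (\sum_(v < n) c = c * n)%N by rewrite sum_nat_const card_ord mulnC.
(* For [`|h| <= 3] and [s = 1, -1] we have [`|h - 3 s| + `|h| = 3 + 2 * (s h)^-]. *)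
have side (s : int) z : s = 1 \/ s = -1 -> s * h z < 0 ->
    ((3 * n)./2 < \sum_v `|h v - (3 * s)%R|)%N.
  move=> sE hz.
  have : (3 * n + 2 * \sum_v (v == z) <= \sum_v `|h v - (3 * s)%R| + \sum_v `|h v|)%N.
    rewrite -sc big_distrr -!big_split /=; apply: leq_sum => v _.
    have := h3 v; case: eqP => [->|_]; case: sE hz => ->; lia.
  by rewrite sh sum_eq1; lia.
move=> k; rewrite /dev; case: (ltgtP k 0) => hk.
- apply: leq_trans (side (-1) x _ _) _; [by auto|lia|].
  by apply: leq_sum => v _; have := h3 v; lia.
- apply: leq_trans (side 1 y _ _) _; [by auto|lia|].
  by apply: leq_sum => v _; have := h3 v; lia.
- by rewrite hk (eq_bigr (fun v => `|h v|%N)) ?sh // => v _; rewrite mulr0 subr0.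
Qed.

(** Lowering |h| by one where it is largest keeps [h] 1-Lipschitz, and keeps both signs because that
    value is at least 2. Repeating this reaches the sum required by [cdiam_mixed_eq]. *)
Lemma cdiam_mixed h x y : lipschitz e h -> (forall v, `|h v| <= 3)%N -> 0 < h x -> h y < 0 ->
  (3 * n < 2 * \sum_v `|h v|)%N -> ((3 * n)./2 < cdiam e)%N.
Proof.
move=> lh h3 hx hy sh.
have [m sm] : exists m, (\sum_v `|h v| = (3 * n)./2.+1 + m)%N.
  by exists (\sum_v `|h v| - (3 * n)./2.+1)%N; lia.
elim: m => [|m IH] in h lh h3 hx hy sh sm *; first by rewrite addn0 in sm; apply: (cdiam_mixed_eq lh h3 hx hy).
case: (@arg_maxnP _ x xpredT (fun v => `|h v|%N) isT) => v _ vmax.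
have hv : (1 < `|h v|)%N.
  rewrite ltnNge; apply/negP => hv; have : (\sum_v `|h v| <= \sum_(v < n) 1)%N.
    by apply: leq_sum => u _; apply: leq_trans hv; apply: vmax.
  by rewrite sum1_card card_ord; lia.
pose h' u := if u == v then (if 0 < h v then h v - 1 else h v + 1) else h u.
have H u : u != v -> `|h' u|%N = `|h u|%N by rewrite /h' => /negbTE ->.
have h'v : (`|h' v|.+1 = `|h v|)%N by rewrite /h' eqxx; case: ifP; lia.
have sh' : (\sum_v `|h' v| = (3 * n)./2.+1 + m)%N by have := sum_update H; lia.
apply: (IH h') => //.
- move=> a b /lh; have := vmax a isT; have := vmax b isT; rewrite /h'.
  by case: eqP => [->|_]; case: eqP => [->|_]; do ?case: ifP => ? /=; lia.
- by move=> u; have := h3 u; have := h3 v; rewrite /h'; case: eqP => [->|_]; do ?case: ifP => ? /=; lia.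
- by move: hx; rewrite /h'; case: eqP => [->|//]; case: ifP; lia.
- by move: hy; rewrite /h'; case: eqP => [->|//]; case: ifP; lia.
- by rewrite sh'; lia.
Qed.

Definition nonleaf (u : 'I_n) : Prop := exists x y, [/\ x != y, e u x & e u y].

Lemma cdiam_deep u d p : rooted e u d p -> nonleaf u ->
  (3 * n < 2 * \sum_v minn 3 (d v))%N -> ((3 * n)./2 < cdiam e)%N.
Proof.
move=> rt [x [y [nxy eux euy]]] sd.
(* The branch through [x] is positive, all other branches are negative, among them the one through
   [y]. *)
have [sg [sgr sgs]] := rooted_rec rt true (fun v b => if p v == u then v == x else b).
pose h v : int := if sg v then (minn 3 (d v))%:Z else - (minn 3 (d v))%:Z.
have hE v : `|h v|%N = minn 3 (d v) by rewrite /h; case: ifP; lia.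
have child v : e u v -> v != u /\ p v = u.
  move=> euv; apply: (rooted_edge_up rt); first by case: tr => ->.
  by move: euv; rewrite (rooted_depth1 rt) => /eqP ->; case: rt => ->.
have dx : d x = 1%N by apply/eqP; rewrite -(rooted_depth1 rt).
have dy : d y = 1%N by apply/eqP; rewrite -(rooted_depth1 rt).
apply: (@cdiam_mixed h x y).
- suff par v : v != u -> (`|h v - h (p v)| <= 1)%N.
    by move=> a b; case: (rt) => _ _ -> /orP[]/andP[/par + /eqP <-]; lia.
  move=> nvu; rewrite /h (sgs v nvu); case: (rt) => d0 /(_ v nvu) dv _.
  by case: (eqVneq (p v) u) dv => [->|_] ->; rewrite ?d0; do 2?case: ifP; lia.
- by move=> v; rewrite hE; lia.
- by have [nxu px] := child x eux; rewrite /h (sgs x nxu) px !eqxx dx.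
- have [nyu py] := child y euy.
  by rewrite /h (sgs y nyu) py eqxx eq_sym (negbTE nxy) dy.
- by rewrite (eq_bigr _ (fun v _ => hE v)).
Qed.

Lemma cdiam_far u1 u2 u3 : (6 < n)%N -> u1 != u3 -> nonleaf u1 -> nonleaf u3 ->
  e u1 u2 -> e u2 u3 -> ((3 * n)./2 < cdiam e)%N.
Proof.
move=> n7 n13 l1 l3 e12 e23; have [sym irr _ _] := tr.
have [d1 [p1 rt1]] := tree_root tr u1; have [d3 [p3 rt3]] := tree_root tr u3.
have e32 : e u3 u2 by rewrite sym.
have d12 : d1 u2 = 1%N by apply/eqP; rewrite -(rooted_depth1 rt1).
have d32 : d3 u2 = 1%N by apply/eqP; rewrite -(rooted_depth1 rt3).
have d11 : d1 u1 = 0%N by case: rt1.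
have d33 : d3 u3 = 0%N by case: rt3.
have d13 : d1 u3 = 2%N.
  have := rooted_depth0 rt1 u3; rewrite [u3 == u1]eq_sym (negbTE n13) => d0.
  by have := rooted_edge_depth rt1 e23; rewrite d12; case=> [[h]|//]; rewrite -h in d0.
have d31 : d3 u1 = 2%N.
  have := rooted_depth0 rt3 u1; rewrite (negbTE n13) => d0.
  by have := rooted_edge_depth rt3 e12; rewrite d32; case=> [//|[h]]; rewrite -h in d0.
have par v : ~~ odd (d1 v + d3 v).
  move: v; apply: (tree_ind (r := u1) tr); first by rewrite d11 d31.
  by move=> a b eab; have := rooted_edge_depth rt1 eab; have := rooted_edge_depth rt3 eab; lia.
(* Both distances have the same parity, and only [u2] is at distance 1 from both [u1] and [u3], so
   elsewhere the truncated distances add up to at least 4. At [u1], [u2] and [u3] they add up to 2,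
   whence the correction. *)
have key v : (4 <= minn 3 (d1 v) + minn 3 (d3 v) + 2 * ((v == u1) + (v == u2) + (v == u3)))%N.
  have [->|n1] := eqVneq v u1; first by rewrite d31; lia.
  have [->|n2] := eqVneq v u2; first by rewrite d12 d32; lia.
  have [->|n3] := eqVneq v u3; first by rewrite d13; lia.
  have := rooted_depth0 rt1 v; have := rooted_depth0 rt3 v; rewrite (negbTE n1) (negbTE n3).
  have : ~ (d1 v = 1%N /\ d3 v = 1%N).
    case=> d1v d3v; have e3v : e u3 v by rewrite (rooted_depth1 rt3) d3v.
    have [_ E1] := rooted_edge_up rt1 e3v (etrans d13 (congr1 S (esym d1v))).
    have [_ E2] := rooted_edge_up rt1 e32 (etrans d13 (congr1 S (esym d12))).
    by rewrite -E1 E2 eqxx in n2.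
  by have := par v; lia.
have : (\sum_(v < n) 4 <= \sum_v (minn 3 (d1 v) + minn 3 (d3 v)
          + 2 * ((v == u1) + (v == u2) + (v == u3))))%N by apply: leq_sum.
have S2 : (\sum_v 2 * ((v == u1) + (v == u2) + (v == u3)) = 6)%N.
  transitivity (2 * (\sum_v (v == u1) + \sum_v (v == u2) + \sum_v (v == u3)))%N.
    by rewrite -!big_split big_distrr.
  by rewrite !sum_eq1.
rewrite sum_nat_const card_ord big_split /= S2 big_split /= => S4.
(* Two sums of at most 3 n / 2 would give 4 n - 6 <= 3 n, against n > 6. *)
case: (ltnP (3 * n) (2 * \sum_v minn 3 (d1 v))) => [|s1]; first exact: (cdiam_deep rt1).
apply: (cdiam_deep rt3) => //; move: S4 s1.
by move: (\sum_v minn 3 (d1 v))%N (\sum_v minn 3 (d3 v))%N => a b; lia.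
Qed.

(** At each vertex the distances to [3 * k] and [3 * k + 3] add up to 3, so the smaller deviation is
    at most half of [3 * n]. *)
Lemma dev_window D (k : int) : (forall v, 3 * k <= D v <= 3 * k + 3) ->
  exists k' : int, (dev D (3 * k') <= (3 * n)./2)%N.
Proof.
move=> H; have S : (dev D (3 * k) + dev D (3 * (k + 1)) = 3 * n)%N.
  have sc : (\sum_(v < n) 3 = 3 * n)%N by rewrite sum_nat_const card_ord mulnC.
  by rewrite /dev -big_split /= -sc; apply: eq_bigr => v _; have := H v; lia.
case: (leqP (dev D (3 * k)) (3 * n)./2) => le; first by exists k.
by exists (k + 1); lia.
Qed.

Lemma cdiam_star c : (forall v, v != c -> e c v) -> (cdiam e <= (3 * n)./2)%N.
Proof.
move=> H; apply: (cdiam_le tr) => D lD.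
have nb v : (`|D c - D v| <= 1)%N by case: (eqVneq v c) => [->|/H/lD//]; lia.
case: (boolP (3 %| D c)%Z) => m3.
  exists (D c %/ 3)%Z; apply: (@leq_trans (\sum_(v < n) 1)%N).
    by apply: leq_sum => v _; have := nb v; lia.
  by rewrite sum1_card card_ord; lia.
by apply: (@dev_window D (D c %/ 3)%Z) => v; have := nb v; lia.
Qed.

(** If [D] is a multiple of 3 at one center, only leaves of the other center can be at distance 2
    from that value, and they number at most n / 2 + 1. Otherwise both centers lie strictly between
    the same consecutive multiples of 3, and [dev_window] applies. *)
Lemma cdiam_double_star c1 c2 (A B : {set 'I_n}) : e c1 c2 ->
  (forall v, [\/ v = c1, v = c2, (v \in A) && e c1 v | (v \in B) && e c2 v]) ->
  (2 * #|A| <= n + 2)%N -> (2 * #|B| <= n + 2)%N -> (cdiam e <= (3 * n)./2)%N.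
Proof.
move=> e12 cov cA cB; have [sym irr _ _] := tr; apply: (cdiam_le tr) => D lD.
have near x y (X Y : {set 'I_n}) : e x y -> (2 * #|X| <= n + 2)%N -> (3 %| D y)%Z ->
    (forall v, [\/ v = x, v = y, (v \in X) && e x v | (v \in Y) && e y v]) ->
    exists k : int, (dev D (3 * k) <= (3 * n)./2)%N.
  move=> exy cX m3 cv; exists (D y %/ 3)%Z.
  have : (dev D (3 * (D y %/ 3)%Z) + \sum_v (v == y) <= \sum_(v < n) 1 + #|X|)%N.
    rewrite -sum1_card [X in (_ <= _ + X)%N]big_mkcond /dev -!big_split /=.
    apply: leq_sum => v _; have nxy : x != y by apply: contraTneq exy => ->; rewrite irr.
    case: (cv v) => [->|->|/andP[-> /lD] | /andP[_ eyv]].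
    - by rewrite (negbTE nxy); have := lD _ _ exy; case: ifP; lia.
    - by rewrite eqxx; case: ifP; lia.
    - by have := lD _ _ exy; case: eqP => [->|]; lia.
    - by case: eqP eyv => [->|_ /lD]; [rewrite irr | case: ifP; lia].
  by rewrite sum1_card card_ord sum_eq1; lia.
case: (boolP (3 %| D c2)%Z) => m2; first exact: (near c1 c2 A B).
case: (boolP (3 %| D c1)%Z) => m1.
  by apply: (near c2 c1 B A) => // [|v]; [rewrite sym | case: (cov v) => h; constructor].
apply: (@dev_window D (D c1 %/ 3)%Z) => v; have := lD _ _ e12.
by case: (cov v) => [->|->|/andP[_ /lD]|/andP[_ /lD]]; lia.
Qed.

End Minimum.

Local Close Scope ring_scope.

(** * Stars, double stars and the other trees *)

Section Classification.
Variables (n : nat) (e : rel 'I_n).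
Hypotheses (n_gt0 : 0 < n) (tr : is_tree e).
Let r0 : 'I_n := Ordinal n_gt0.

Lemma star_isomorphic c : (forall v, v != c -> e c v) -> isomorphic e (star_rel n).
Proof.
move=> H; have [d [p rt]] := tree_root tr c.
have d1 v : v != c -> d v = 1 by move=> /H; rewrite (rooted_depth1 rt) => /eqP.
have f0 v : (tperm c r0 v == 0 :> nat) = (v == c).
  by rewrite -(inj_eq (@perm_inj _ (tperm c r0)) v c) tpermL.
exists (tperm c r0); split; first by apply: injF_bij; apply: perm_inj.
move=> u v; rewrite /star_rel !f0; have [sym irr _ _] := tr.
have [->|nu] := eqVneq u c; have [->|nv] := eqVneq v c => /=.
- by rewrite irr.
- by rewrite H.
- by rewrite sym H.
by apply/esym/negP => /(rooted_edge_depth rt); rewrite !d1 //; case.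
Qed.

Lemma isomorphic_star : isomorphic e (star_rel n) -> exists c, forall v, v != c -> e c v.
Proof.
case=> f [[g fK gK] fE]; exists (g r0) => v nv; rewrite -fE gK /star_rel /= andbF orbF.
by apply: contra nv => /eqP h; rewrite -(fK v); apply/eqP; congr g; apply: val_inj.
Qed.

Definition is_double_star (c1 c2 : 'I_n) (A B : {set 'I_n}) : Prop :=
  [/\ c1 != c2, (forall v, [|| v == c1, v == c2, v \in A | v \in B]),
      [/\ c1 \notin A, c2 \notin A, c1 \notin B, c2 \notin B & [disjoint A & B]]
    & forall u v, e u v =
        let adj u v := [|| (u == c1) && (v == c2), (u == c1) && (v \in A)
                         | (u == c2) && (v \in B)] in
        adj u v || adj v u].

(** Root the tree at a non-leaf [c]. A vertex of depth 3, or two vertices of depth 2 with different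
    parents, give two non-leaves with a common neighbor. Otherwise all vertices of depth 2 hang from
    one child of [c], the second center. *)
Lemma tree_classification :
  [\/ exists c, forall v, v != c -> e c v,
      exists u1 u2 u3, [/\ u1 != u3, nonleaf e u1, nonleaf e u3, e u1 u2 & e u2 u3]
    | exists c1 c2 A B, [/\ is_double_star c1 c2 A B, A != set0 & B != set0]].
Proof.
have [sym irr _ _] := tr.
have star_or c d p : rooted e c d p ->
    (exists c, forall v, v != c -> e c v) \/ exists x, 1 < d x.
  move=> rt; case: (boolP [exists x, 1 < d x]) => [/existsP|]; first by right.
  rewrite negb_exists => /forallP H; left; exists c => v nv.
  rewrite (rooted_depth1 rt) eqn_leq leqNgt H /= lt0n (rooted_depth0 rt) //.
have inner c d p x : rooted e c d p -> 1 < d x -> p x != c /\ nonleaf e (p x).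
  move=> rt dx; have [d0 ds _] := rt.
  have nx : x != c by apply: contraTneq dx => ->; rewrite d0.
  have npx : p x != c by rewrite -(rooted_depth0 rt); have := ds x nx; lia.
  split=> //; exists x, (p (p x)); split; last exact: (rooted_parent rt).
    by apply/eqP => E; have := ds _ npx; have := ds _ nx; rewrite -E; lia.
  by rewrite sym; apply: (rooted_parent rt).
(* The first root is arbitrary; it serves to find [c] as the parent of a vertex of depth above 1. *)
have [d' [p' rt']] := tree_root tr r0.
have [?|[x' dx']] := star_or _ _ _ rt'; first by constructor 1.
have [_ lc] := inner _ _ _ _ rt' dx'; move: (p' x') lc => c lc {x' dx' rt'}.
have [d [p rt]] := tree_root tr c; have [d0 ds eE] := rt.
have [?|[x dx]] := star_or _ _ _ rt; first by constructor 1.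
have nc v : 0 < d v -> v != c by rewrite lt0n (rooted_depth0 rt).
have pe v : v != c -> e v (p v) := @rooted_parent _ _ _ _ _ rt v.
case: (boolP [exists x, 2 < d x]) => [/existsP[y dy]|].
  have ny : y != c by apply: nc; lia.
  have dpy : 1 < d (p y) by have := ds y ny; lia.
  have [npy ly] := inner _ _ _ _ rt (ltnW dy).
  have [nppy _] := inner _ _ _ _ rt dpy.
  constructor 2; exists (p y), (p (p y)), (p (p (p y))); split=> //.
  - by apply/eqP => E; have := ds _ npy; have := ds _ nppy; rewrite -E; lia.
  - have [->//|nc3] := eqVneq (p (p (p y))) c.
    have [] := inner _ _ _ (p (p y)) rt => //.
    by rewrite (ds _ nppy) ltnS lt0n (rooted_depth0 rt).
  - exact: pe.
  - exact: pe.
rewrite negb_exists => /forallP H2; have {}H2 v : d v <= 2 by rewrite leqNgt.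
have p1 v : d v = 1 -> p v = c.
  by move=> dv; apply/eqP; rewrite -(rooted_depth0 rt); have := ds v (nc v _); rewrite dv; lia.
have cpe v : d v = 2 -> e c (p v).
  by move=> dv; rewrite (rooted_depth1 rt); have := ds v (nc v _); rewrite dv; lia.
case: (boolP [exists y, (d y == 2) && (p y != p x)]) => [/existsP[y /andP[/eqP dy npy]]|].
  have dx2 : d x = 2 by have := H2 x; lia.
  constructor 2; exists (p y), c, (p x); split=> //; last exact: cpe.
  - by have [|] := inner _ _ _ y rt; rewrite ?dy.
  - by have [|] := inner _ _ _ x rt.
  - by rewrite sym cpe.
rewrite negb_exists => /forallP Hp.
have {}Hp v : d v = 2 -> p v = p x.
  by move=> dv; have := Hp v; rewrite dv eqxx /= negbK => /eqP.
have dx2 : d x = 2 by have := H2 x; lia.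
have dc2 : d (p x) = 1 by apply/eqP; rewrite -(rooted_depth1 rt) cpe.
constructor 3; exists c, (p x), [set v | (d v == 1) && (v != p x)], [set v | d v == 2].
split; last by apply/set0Pn; exists x; rewrite inE dx2.
- have cE v : (v == c) = (d v == 0) by rewrite (rooted_depth0 rt).
  split.
  + by rewrite eq_sym cE dc2.
  + move=> v; rewrite !inE cE; have := H2 v; case: (v == p x) => /=; lia.
  + split; rewrite ?inE ?d0 ?dc2 ?eqxx //.
    by rewrite disjoints_subset; apply/subsetP => v; rewrite !inE => /andP[/eqP -> _].
  + move=> u v; rewrite eE /= !inE orbC; suff half a b : (b != c) && (p b == a)
        = [|| (a == c) && (b == p x), (a == c) && ((d b == 1) && (b != p x))
            | (a == p x) && (d b == 2)] by rewrite !half.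
    have [E|db] := posnP (d b).
      rewrite cE E /= !andbF; case: (eqVneq b (p x)) => [bE|]; last by rewrite andbF.
      by rewrite bE dc2 in E.
    rewrite nc //; have [db2|db1] := ltnP 1 (d b).
      have db' : d b = 2 by have := H2 b; lia.
      rewrite db' /= !andbF /= andbT (Hp b db') eq_sym.
      case: (eqVneq b (p x)) => [E|]; last by rewrite andbF.
      by rewrite E dc2 in db'.
    have db' : d b = 1 by lia.
    rewrite db' /= (p1 b db') !andbF orbF eq_sym.
    by case: (b == p x); rewrite ?andbT ?andbF ?orbF.
(* As a non-leaf, [c] has a neighbor other than [p x]. *)
- have [y [z [nyz ey ez]]] := lc; apply/set0Pn.
  move: ey ez; rewrite !(rooted_depth1 rt) => dy dz.
  have [E|nyx] := eqVneq y (p x); first by exists z; rewrite inE dz -E eq_sym.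
  by exists y; rewrite inE dy.
Qed.

End Classification.

(** * The trees attaining the minimum *)

Section MinimumTrees.
Variables (n : nat) (e : rel 'I_n).
Hypotheses (n_gt6 : 6 < n) (tr : is_tree e).

Lemma double_star_card c1 c2 A B : is_double_star e c1 c2 A B -> #|A| + #|B| + 2 = n.
Proof.
case=> n12 cov [c1A c2A c1B c2B dAB] _; rewrite -[RHS](card_ord n) -[RHS]sum1_card.
transitivity (\sum_v ((v == c1) + (v == c2) + (v \in A) + (v \in B))).
  have cX (X : {set 'I_n}) : \sum_v (v \in X : nat) = #|X|.
    by rewrite -sum1_card [RHS]big_mkcond; apply: eq_bigr => v _; case: (v \in X).
  by rewrite !big_split /= !sum_eq1 !cX addnC addnA.
apply: eq_bigr => v _; have := cov v.
have [->|n1] := eqVneq v c1; first by rewrite (negbTE n12) (negbTE c1A) (negbTE c1B).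
have [->|n2] := eqVneq v c2; first by rewrite (negbTE c2A) (negbTE c2B).
case: (boolP (v \in A)) => [vA|_ /= ->//].
by rewrite (disjointFr dAB vA).
Qed.

Lemma double_star_isomorphic c1 c2 A B : is_double_star e c1 c2 A B ->
  isomorphic e (dstar_rel n #|A|).
Proof.
move=> ds; have cn := double_star_card ds.
case: ds => n12 cov [c1A c2A c1B c2B dAB] eE.
(* The order matches the numbering of [dstar_rel]: centers, leaves of [c1], leaves of [c2]. *)
pose s := [:: c1, c2 & enum A ++ enum B].
have ss : size s = n by rewrite /= size_cat -!cardE -[RHS]cn addn2.
have ms v : v \in s by rewrite !inE mem_cat !mem_enum.
have lt v : index v s < n by rewrite -[X in _ < X]ss index_mem.
pose f v := Ordinal (lt v).
have iA v : v \in A -> index v (enum A) < #|A| by rewrite cardE index_mem mem_enum.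
have f0 v : (f v == 0 :> nat) = (v == c1) by rewrite /= [c1 == v]eq_sym; case: (v == c1).
have f1 v : (f v == 1 :> nat) = (v == c2).
  rewrite /= [c1 == v]eq_sym [c2 == v]eq_sym.
  by have [->|n1] := eqVneq v c1; [rewrite (negbTE n12) | case: (v == c2)].
have fA v : (2 <= f v <= #|A|.+1) = (v \in A).
  rewrite /= [c1 == v]eq_sym [c2 == v]eq_sym index_cat mem_enum.
  have [->|n1] := eqVneq v c1; first by rewrite (negbTE c1A).
  have [->|n2] := eqVneq v c2; first by rewrite (negbTE c2A).
  case: ifPn => vA; first by rewrite !ltnS iA.
  by rewrite -cardE; move: (index v _) #|A| => i k; lia.
have fB v : (#|A|.+2 <= f v) = (v \in B).
  rewrite /= [c1 == v]eq_sym [c2 == v]eq_sym index_cat mem_enum.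
  have [->|n1] := eqVneq v c1; first by rewrite (negbTE c1B).
  have [->|n2] := eqVneq v c2; first by rewrite (negbTE c2B).
  case: ifPn => vA.
    by rewrite (disjointFr dAB vA) !ltnS leqNgt iA.
  have := cov v; rewrite (negbTE n1) (negbTE n2) (negbTE vA) /= => ->.
  by rewrite -cardE !ltnS leq_addr.
exists f; split.
  apply: injF_bij => u v /(congr1 val) /= E.
  by rewrite -(nth_index u (ms u)) -[RHS](nth_index u (ms v)) /= E.
by move=> u v; rewrite eE /dstar_rel /dstar_adj !f0 !f1 !fA !fB.
Qed.

(** As n = a + b + 2, the balance conditions say that each leaf set has at most n / 2 + 1 elements,
    as [cdiam_double_star] requires. *)
Lemma isomorphic_double_star a b : 1 <= a -> 1 <= b -> a + b + 2 = n -> a <= b + 4 -> b <= a + 4 ->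
  isomorphic e (dstar_rel n a) -> cdiam e <= (3 * n)./2.
Proof.
move=> a1 b1 abn ab ba [f [[g fK gK] fE]].
have lt0 : 0 < n by lia. have lt1 : 1 < n by lia.
have fsum (P : pred nat) : #|[set v | P (f v)]| = \sum_(i < n) (P i : nat).
  rewrite -sum1_card big_mkcond [RHS](reindex f) /=; last by exists g => v _.
  by apply: eq_bigr => v _; rewrite inE; case: (P _).
have s0 k : \sum_(i < n) ((i < k) : nat) = minn k n by exact: sum_ltn.
apply: (@cdiam_double_star _ _ lt0 tr (g (Ordinal lt0)) (g (Ordinal lt1))
  [set v | 2 <= f v <= a.+1] [set v | a.+2 <= f v]).
- by rewrite -fE !gK.
- move=> v; have [E|n0] := eqVneq (f v) (Ordinal lt0); first by constructor 1; rewrite -E fK.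
  have [E|n1] := eqVneq (f v) (Ordinal lt1); first by constructor 2; rewrite -E fK.
  move: n0 n1; rewrite -!val_eqE /= => n0 n1; rewrite !inE -!fE !gK /dstar_rel /dstar_adj /=.
  by case: (leqP (f v) a.+1) => h; [constructor 3|constructor 4]; lia.
- have := fsum (fun i => 2 <= i <= a.+1) => /= ->.
  have : \sum_(i < n) (2 <= i <= a.+1 : nat) + \sum_(i < n) (i < 2 : nat) = a.+2.
    transitivity (\sum_(i < n) (i < a.+2 : nat)); last by rewrite s0; lia.
    by rewrite -big_split /=; apply: eq_bigr => i _; lia.
  by rewrite s0; move: (\sum_(i < n) _) => m; lia.
- have := fsum (fun i => a.+2 <= i) => /= ->.
  have : \sum_(i < n) (a.+2 <= i : nat) + \sum_(i < n) (i < a.+2 : nat) = n.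
    rewrite -big_split /= -[RHS](card_ord n) -sum1_card.
    by apply: eq_bigr => i _; lia.
  by rewrite s0; move: (\sum_(i < n) _) => m; lia.
Qed.

(** The vertices of [Y] are at distance at least 2 from [x], so the truncated distances sum to at
    least n - 1 + |Y|, enough for [cdiam_deep]. In a double star, [Y] will be the leaf set of the
    other center. *)
Lemma cdiam_unbalanced x (Y : {set 'I_n}) : nonleaf e x ->
  (forall v, v \in Y -> (v != x) && ~~ e x v) -> n + 2 < 2 * #|Y| -> (3 * n)./2 < cdiam e.
Proof.
move=> lx HY cY; have [d [p rt]] := tree_root tr x; apply: (cdiam_deep _ tr rt) => //; first by lia.
have : \sum_(v < n) 1 + #|Y| <= \sum_v minn 3 (d v) + \sum_v (v == x).
  rewrite -sum1_card [X in _ + X <= _]big_mkcond -!big_split /=; apply: leq_sum => v _.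
  have := HY v; rewrite (rooted_depth1 rt) -(rooted_depth0 rt).
  by case: (v \in Y); [move/(_ isT)|move=> _]; lia.
by rewrite sum1_card card_ord sum_eq1; move: (\sum_v minn 3 (d v)) => m; lia.
Qed.

Lemma cdiam_min_iff : cdiam e = (3 * n)./2 <->
  (isomorphic e (star_rel n) \/
   exists a b : nat, [/\ 1 <= a, 1 <= b, a + b + 2 = n,
                         (a <= b + 4) && (b <= a + 4) & isomorphic e (dstar_rel n a)]).
Proof.
have n_gt0 : 0 < n by lia.
split=> [dE|iso]; last first.
  apply/eqP; rewrite eqn_leq cdiam_lower // andbT; case: iso.
    by move/(isomorphic_star n_gt0) => [c]; apply: cdiam_star.
  by case=> a [b [a1 b1 abn /andP[ab ba]]]; apply: isomorphic_double_star abn _ _.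
have small : ~ (3 * n)./2 < cdiam e by rewrite dE ltnn.
have [[c Hc]|[u1 [u2 [u3 [n13 l1 l3 e12 e23]]]]|] := tree_classification n_gt0 tr.
- by left; apply: star_isomorphic Hc.
- by case: small; apply: (cdiam_far _ tr) l1 l3 e12 e23.
case=> c1 [c2 [A [B [ds /set0Pn[a aA] /set0Pn[b bB]]]]]; right.
have cn := double_star_card ds.
have [n12 cov [c1A c2A c1B c2B dAB] eE] := ds.
have l1 : nonleaf e c1.
  exists c2, a; split; first by apply: contraNneq c2A => ->.
    by rewrite eE /= !eqxx.
  by rewrite eE /= eqxx aA !orbT.
have l2 : nonleaf e c2.
  exists c1, b; split; first by apply: contraNneq c1B => ->.
    by rewrite eE /= !eqxx !orbT.
  by rewrite eE /= eqxx bB !orbT.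
exists #|A|, #|B|; split=> //; last exact: double_star_isomorphic ds.
- by rewrite lt0n cards_eq0; apply/set0Pn; exists a.
- by rewrite lt0n cards_eq0; apply/set0Pn; exists b.
apply/negPn/negP => /nandP[]; rewrite -ltnNge => lt; apply: small.
  apply: (@cdiam_unbalanced c2 A) => // [v vA|]; last by lia.
  have nv1 : v != c1 by apply: contraTneq vA => ->.
  have nv2 : v != c2 by apply: contraTneq vA => ->.
  rewrite nv2 eE /= (disjointFr dAB vA) (negbTE nv1) (negbTE nv2).
  by rewrite eq_sym (negbTE n12) /= !andbF.
apply: (@cdiam_unbalanced c1 B) => // [v vB|]; last by lia.
have nv1 : v != c1 by apply: contraTneq vB => ->.
have nv2 : v != c2 by apply: contraTneq vB => ->.
rewrite nv1 eE /= (disjointFl dAB vB) (negbTE nv1) (negbTE nv2).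
by rewrite (negbTE n12) /= !andbF.
Qed.

End MinimumTrees.

(** * The maximum *)

Lemma binS2 k : 'C(k.+1, 2) = 'C(k, 2) + k.
Proof. by rewrite binS bin1 addnC. Qed.

Lemma bin2_double k : 2 * 'C(k.+1, 2) = k * k.+1.
Proof. by elim: k => [|k IH]; [rewrite bin_small | rewrite binS2 mulnDr IH; lia]. Qed.

(** * Sums over levels without gaps *)

Section Layers.
Variables (n : nat) (h : 'I_n -> nat).
Implicit Type A : {set 'I_n}.

(** On a nonempty [A], the values of [h] fill an interval starting at 1, possibly with
    repetitions. *)
Definition gapless A : Prop := forall v, v \in A ->
  0 < h v /\ (1 < h v -> exists2 u, u \in A & (h u).+1 = h v).

Lemma gapless_le A v : gapless A -> v \in A -> h v <= #|A|.
Proof.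
move=> gA vA; apply: (@leq_trans #|[set u in A | h u <= h v]|); last first.
  by apply: subset_leq_card; apply/subsetP => u; rewrite inE => /andP[].
have [k] := ubnP (h v); elim: k v vA => // k IH v vA; rewrite ltnS => hv.
have [hv0 hv1] := gA v vA; case: (ltnP 1 (h v)) => [/hv1[u uA hu]|hv2]; last first.
  by apply: leq_trans hv2 _; rewrite card_gt0; apply/set0Pn; exists v; rewrite inE vA leqnn.
rewrite -hu; apply: leq_ltn_trans (IH u uA _) _; first by rewrite hu.
apply: proper_card; apply/properP; split.
  by apply/subsetP => x; rewrite !inE => /andP[-> /= le]; apply: leqW.
by exists v; rewrite inE vA /= -?hu ?ltnn.
Qed.

(* Remove the elements by decreasing [h]: when [i] of them are left, the next has [h <= i]. *)
Lemma gapless_sum A : gapless A ->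
  \sum_(v in A) h v <= 'C(#|A|.+1, 2) /\
  (\sum_(v in A) h v = 'C(#|A|.+1, 2) -> {in A &, injective h}).
Proof.
have [k] := ubnP #|A|; elim: k A => // k IH A; rewrite ltnS => cA gA.
have [->|/set0Pn[v0 v0A]] := eqVneq A set0.
  by rewrite big_set0; split=> // _ u v; rewrite inE.
case: (arg_maxnP h v0A) => v vA vmax; have {}vA : v \in A := vA.
have cE : #|A| = #|A :\ v|.+1 by rewrite (cardsD1 v A) vA.
have gA' : gapless (A :\ v).
  move=> u; rewrite !inE => /andP[nuv uA]; have [hu0 hu1] := gA u uA; split=> // /hu1[w wA hw].
  exists w => //; rewrite !inE wA andbT; apply: contraTneq (vmax u uA) => <-.
  by rewrite /= -hw ltnn.
have [||le eqi] := IH (A :\ v); [by rewrite cE in cA|by []|].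
have hv := gapless_le gA vA.
rewrite (bigD1 v) //= (eq_bigl [in A :\ v]); last by move=> u; rewrite !inE andbC.
move: le eqi hv; rewrite cE; set m := #|A :\ v|; set S := \sum_(u in _) _ => le eqi hv.
have bE := binS2 m.+1; split; first by rewrite bE; lia.
(* Equality forces the removed maximum to be [m.+1], while the remaining values are at most [m]. *)
rewrite bE => E; have hvE : h v = m.+1 by lia.
have inj : {in A :\ v &, injective h} by apply: eqi; lia.
have small u : u \in A -> u != v -> h u < h v.
  by move=> uA nuv; rewrite hvE ltnS; apply: gapless_le gA' _; rewrite !inE nuv.
move=> x y xA yA hxy; have [xv|nx] := eqVneq x v; have [yv|ny] := eqVneq y v.
- by rewrite xv yv.
- by have := small y yA ny; rewrite -hxy xv ltnn.
- by have := small x xA nx; rewrite hxy yv ltnn.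
by apply: inj => //; rewrite !inE ?nx ?ny.
Qed.

End Layers.

(** The bound is the sum of the distances to position M on the path 0, ..., n - 1, with M vertices
    on one side and H + 1 on the other. *)
Lemma max_boundE n : 6 < n -> exists H M : nat,
  [/\ n./2 = H, n = H + M + 2, (M + 2 = H) \/ (M + 1 = H), 1 < M
    & max_bound n = 'C(M.+1, 2) + 'C(H.+1, 2) + H + 1].
Proof.
move=> n7; exists n./2, (uphalf n - 2); split=> //; try lia.
rewrite /max_bound addn2 (binS2 n./2.+1) (_ : (uphalf n).-1 = (uphalf n - 2).+1); last by lia.
by rewrite -!addnA addn1.
Qed.

(** For a median divisible by 3, with [q] vertices above it and [l] below. *)
Lemma max_bound_center n q l : 6 < n -> q <= n./2 -> l <= n./2 -> q + l < n ->
  'C(q.+1, 2) + 'C(l.+1, 2) < max_bound n.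
Proof.
move=> /max_boundE[H [M [-> nE HM M2 ->]]] qH lH qln.
have bM := binS2 M.+1.
case: (leqP l M.+1) => lM.
  have := @leq_bin2l q.+1 H.+1 2 qH; have := @leq_bin2l l.+1 M.+2 2 lM; lia.
have := @leq_bin2l l.+1 H.+1 2 lH; have := @leq_bin2l q.+1 M.+2 2; lia.
Qed.

Lemma bin2_lt j k : j < k -> 1 < k -> 'C(j, 2) < 'C(k, 2).
Proof.
case: k => // k jk k1; apply: leq_ltn_trans (@leq_bin2l j k 2 jk) _.
by rewrite binS2; lia.
Qed.

(** For a median 3 k + 1 measured from 3 k, with [q'] vertices above the median and [q] above 3 k.
    Of the other [n - q] vertices one lies at 3 k itself and costs nothing. *)
Lemma max_bound_side n q' q : 6 < n -> q' <= n./2 -> q' < q -> q < n -> n - q <= n./2 ->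
  'C(q'.+1, 2) + q + 'C(n - q, 2) <= max_bound n /\
  ('C(q'.+1, 2) + q + 'C(n - q, 2) = max_bound n -> q' = n./2 /\ q = n./2.+1).
Proof.
move=> /max_boundE[H [M [-> nE HM M2 ->]]] q'H q'q qn nqH.
have [w wE] : exists w, n - q = w.+1 by exists (n - q).-1; lia.
have bH := @leq_bin2l q'.+1 H.+1 2 q'H; rewrite wE.
case: (ltngtP w M) => wM.
- have := binS2 w; have := binS2 M; have := bin2_lt wM M2; lia.
- have qE : q = H by lia.
  have wE' : w = M.+1 by lia.
  rewrite wE'; have := binS2 M.+1; have := binS2 H; have := @leq_bin2l q'.+1 H 2; lia.
- rewrite wM; have qE : q = H.+1 by lia.
  split; first by lia.
  move=> E; split=> //; case: (ltngtP q' H) => // [lt|]; last by lia.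
  by have := @bin2_lt q'.+1 H.+1; lia.
Qed.

(** The same with q = n, when no vertex is below the median. *)
Lemma max_bound_end n q' : 6 < n -> q' <= n./2 -> 'C(q'.+1, 2) + n <= max_bound n /\
  ('C(q'.+1, 2) + n = max_bound n -> q' = n./2).
Proof.
move=> /max_boundE[H [M [-> nE HM M2 ->]]] q'H.
have bH := @leq_bin2l q'.+1 H.+1 2 q'H.
have bM : M.+1 <= 'C(M.+1, 2) by have := bin2_double M; nia.
split; first by lia.
move=> E; case: (ltngtP q' H) => // [lt|]; last by lia.
by have := @bin2_lt q'.+1 H.+1; lia.
Qed.

Local Open Scope ring_scope.

(** * Level sets and medians of 1-Lipschitz functions *)

Section Lipschitz.
Variables (n : nat) (e : rel 'I_n).
Hypothesis tr : is_tree e.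
Implicit Types (D : 'I_n -> int) (t : int).

(** Discrete intermediate values: if [D] skipped [t], connectedness would keep the whole tree below
    [t]. *)
Lemma lipschitz_between D u w t : lipschitz e D -> D u <= t -> t <= D w -> exists v, D v = t.
Proof.
move=> lD ut tw; case: (boolP [exists v, D v == t]) => [/existsP[v /eqP]|]; first by exists v.
rewrite negb_exists => /forallP H; suff : D w < t by lia.
have H' v : D v <> t by move/eqP; apply/negP.
move: w {tw}; apply: (tree_ind tr (r := u)); first by have := H' u; lia.
by move=> a b eab; have := lD _ _ eab; have := H' b; lia.
Qed.

Lemma lipschitzN D : lipschitz e D -> lipschitz e (fun v => - D v).
Proof. by move=> lD u v /lD; lia. Qed.

Definition up D t : {set 'I_n} := [set v | t < D v].
Definition dn D t : {set 'I_n} := [set v | D v < t].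

Lemma upN D t : up (fun v => - D v) t = dn D (- t).
Proof. by apply/setP => v; rewrite !inE; lia. Qed.

Lemma dnN D t : dn (fun v => - D v) t = up D (- t).
Proof. by apply/setP => v; rewrite !inE; lia. Qed.

(** The vertex [w] has a value of at most t + 1, so the levels above [t] are gapless and
    [gapless_sum] applies. *)
Lemma up_sum D t w : lipschitz e D -> D w <= t + 1 ->
  (\sum_(v in up D t) `|D v - t| <= 'C(#|up D t|.+1, 2))%N /\
  ((\sum_(v in up D t) `|D v - t|)%N = 'C(#|up D t|.+1, 2) -> {in up D t &, injective D}).
Proof.
move=> lD Dw; have [|le inj] := @gapless_sum n (fun v => `|D v - t|%N) (up D t).
  move=> v; rewrite inE => tv; split=> [|h1]; first by lia.
  have [||u uE] := @lipschitz_between D w v (D v - 1) lD; [lia|lia|].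
  by exists u; rewrite ?inE uE; lia.
split=> // /inj {}inj x y xA yA xy; apply: inj => //=.
by rewrite xy.
Qed.

Lemma dn_sum D t w : lipschitz e D -> t - 1 <= D w ->
  (\sum_(v in dn D t) `|D v - t| <= 'C(#|dn D t|.+1, 2))%N /\
  ((\sum_(v in dn D t) `|D v - t|)%N = 'C(#|dn D t|.+1, 2) -> {in dn D t &, injective D}).
Proof.
move=> lD Dw; have [|] := @up_sum (fun v => - D v) (- t) w (lipschitzN lD); first by lia.
rewrite upN opprK (eq_bigr (fun v => `|D v - t|%N)) => [le inj|v _]; last by lia.
split=> // /inj {}inj x y xA yA xy; apply: inj => //=; by rewrite xy.
Qed.

Lemma dev_split D t :
  dev D t = (\sum_(v in up D t) `|D v - t| + \sum_(v in dn D t) `|D v - t|)%N.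
Proof.
rewrite /dev !(big_mkcond [in _]) -big_split; apply: eq_bigr => v _ /=.
by rewrite !inE; case: (ltgtP (D v) t) => [_|_|->] /=; rewrite ?addn0 ?subrr.
Qed.

(** Take the least value with at most n / 2 vertices above it. The next lower value fails this, and
    the vertices above that one are the complement of those below the chosen one. *)
Lemma median D : (0 < n)%N -> exists v, (#|up D (D v)| <= n./2)%N /\ (#|dn D (D v)| <= n./2)%N.
Proof.
move=> n_gt0; pose P v := (#|up D (D v)| <= n./2)%N.
have [v0 Pv0] : exists v0, P v0.
  case: (@arg_maxP _ int _ (Ordinal n_gt0) xpredT D isT) => v _ vmax; exists v.
  rewrite /P (_ : up D (D v) = set0) ?cards0 //; apply/setP => u; rewrite !inE.
  by have := vmax u isT; lia.
case: (@arg_minP _ int _ v0 P D Pv0) => v Pv vmin; exists v; split=> //.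
have [->|/set0Pn[w0 w0A]] := eqVneq (dn D (D v)) set0; first by rewrite cards0.
case: (@arg_maxP _ int _ w0 [in dn D (D v)] D w0A) => w wA wmax.
have wv : D w < D v by move: wA; rewrite inE.
have : ~~ P w by apply: contraL wv => /vmin; lia.
rewrite /P; have -> : up D (D w) = ~: dn D (D v).
  apply/setP => u; rewrite !inE; have := wmax u; rewrite inE => H.
  by case: (ltP (D u) (D v)) => uv /=; [have := H uv|]; lia.
by have := cardsC (dn D (D v)); rewrite card_ord; lia.
Qed.

End Lipschitz.

(** * The upper bound and its equality case *)

Section Maximum.
Variables (n : nat) (e : rel 'I_n).
Hypotheses (n_gt6 : (6 < n)%N) (tr : is_tree e).
Implicit Types (D : 'I_n -> int) (t : int).

(** Measured from [t] instead of the median [mu = t + 1], each vertex at or above [mu] costs one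
    more. If some vertex is below [mu], the value [t] is taken. *)
Lemma dev_max_side D v0 (k : int) : lipschitz e D -> D v0 = 3 * k + 1 ->
  (#|up D (D v0)| <= n./2)%N -> (#|dn D (D v0)| <= n./2)%N ->
  exists k : int, (dev D (3 * k) < max_bound n)%N \/
    ((dev D (3 * k) <= max_bound n)%N /\ injective D).
Proof.
move=> lD Dv0; set mu := D v0 in Dv0 *; set t : int := 3 * k in Dv0; move=> upH dnH.
have sub : up D mu \subset up D t by apply/subsetP => v; rewrite !inE; lia.
have v0t : v0 \in up D t by rewrite inE -/mu; lia.
have v0mu : v0 \notin up D mu by rewrite inE -/mu ltxx.
have q'q : (#|up D mu| < #|up D t|)%N.
  by apply: proper_card; apply/properP; split=> //; exists v0.
have dnE : dn D mu = ~: up D t by apply/setP => v; rewrite !inE; lia.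
have cC : (#|up D t| + #|dn D mu| = n)%N by rewrite dnE cardsC card_ord.
have [le1 inj1] : _ /\ _ := @up_sum n e tr D mu v0 lD ltac:(by rewrite -/mu; lia).
have [le2 inj2] : _ /\ _ := @dn_sum n e tr D t v0 lD ltac:(by rewrite -/mu; lia).
have devE : dev D t = (\sum_(v in up D mu) `|D v - mu| + #|up D t|
                      + \sum_(v in dn D t) `|D v - t|)%N.
  rewrite dev_split; congr addn; rewrite -sum1_card !(big_mkcond [in _]) -big_split /=.
  apply: eq_bigr => v _; rewrite !inE; case: (ltgtP (D v) mu) => h.
  - by rewrite (_ : (t < D v) = false) //; lia.
  - by rewrite (_ : (t < D v) = true); lia.
  - by rewrite (_ : (t < D v) = true); lia.
move: le1 inj1 le2 inj2 devE; set S1 := (\sum_(v in up D mu) _)%N; set S2 := (\sum_(v in dn D t) _)%N.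
move=> le1 inj1 le2 inj2 devE.
case: (ltnP #|up D t| n) => [qn|nq].
  have [y Dy] : exists y, D y = t.
    have /set0Pn[x] : dn D mu != set0 by rewrite -card_gt0; lia.
    rewrite inE => xmu; apply: (@lipschitz_between n e tr D x v0 t lD); rewrite -/mu; lia.
  have sub2 : dn D t \subset dn D mu by apply/subsetP => v; rewrite !inE; lia.
  have lz : (#|dn D t| < #|dn D mu|)%N.
    apply: proper_card; apply/properP; split=> //; exists y; first by rewrite inE Dy; lia.
    by rewrite inE Dy ltxx.
  have dnn : #|dn D mu| = (n - #|up D t|)%N by lia.
  have [le eqs] := max_bound_side n_gt6 upH q'q qn ltac:(by rewrite -dnn).
  have le3 := leq_bin2l 2 lz; rewrite dnn in le3.
  exists k; rewrite -/t devE.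
  case: (ltnP (S1 + #|up D t| + S2)%N (max_bound n)) => [|ge]; [by left|right].
  split; first by move: le1 le2 le3 le; lia.
  have [q'E qE] : #|up D mu| = n./2 /\ #|up D t| = n./2.+1.
    by apply: eqs; move: le1 le2 le3 le ge; lia.
  have {}inj1 : {in up D mu &, injective D} by apply: inj1; move: le1 le2 le3 le ge; lia.
  have {}inj2 : {in dn D t &, injective D} by apply: inj2; move: le1 le2 le3 le ge; lia.
  have lE : #|dn D mu| = #|dn D t|.+1.
    apply/eqP; rewrite eqn_leq lz andbT leqNgt; apply/negP => lt.
    by have := bin2_lt lt; rewrite dnn; move: le1 le2 le3 le ge; lia.
  (* The forced cardinalities leave one vertex each at the levels [mu] and [t]; [inj1] and [inj2]
     cover the other levels. *)
  have /card_le1_eqP one1 : (#|up D t :\: up D mu| <= 1)%N by rewrite cardsDS // q'E qE subSnn.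
  have /card_le1_eqP one2 : (#|dn D mu :\: dn D t| <= 1)%N by rewrite cardsDS // lE subSnn.
  move=> x x' E; case: (ltgtP (D x) mu) => h.
  - case: (ltgtP (D x) t) => h'.
    + by apply: inj2; rewrite ?inE -?E.
    + by move: h h'; lia.
    + by apply: one2; rewrite !inE -?E h' ltxx -h' h.
  - by apply: inj1; rewrite ?inE -?E.
  - by apply: one1; rewrite !inE -?E h ltxx /=; lia.
have upT v : mu <= D v.
  have : v \notin dn D mu; last by rewrite inE; lia.
  by rewrite (_ : dn D mu = set0) ?inE //; apply/eqP; rewrite -cards_eq0; lia.
have S20 : S2 = 0%N by rewrite /S2 big1 // => v; rewrite inE; have := upT v; lia.
have qE : #|up D t| = n by move: cC nq; lia.
rewrite S20 qE addn0 in devE.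
have [le eqs] := max_bound_end n_gt6 upH.
case: (ltnP (dev D t) (max_bound n)) => [lt|ge]; first by exists k; left.
have SE : (S1 + n = max_bound n)%N by move: le1 le devE ge; lia.
have q'E : #|up D mu| = n./2 by apply: eqs; move: le1 le devE ge; lia.
have {}inj1 : {in up D mu &, injective D} by apply: inj1; move: le1 le devE ge; lia.
(* Now [D = mu] on half of the vertices and [mu + 1, mu + 2, ...] on the others, so [t + 3]
   is better than [t]; this happens only for [n = 7, 8]. *)
exists (k + 1); left; rewrite (_ : 3 * (k + 1) = t + 3); last by rewrite /t; lia.
have one : (\sum_v (D v == (mu + 1)%R) <= 1)%N.
  have : (#|[set v | D v == (mu + 1)%R]| <= 1)%N.
    apply/card_le1_eqP => x y; rewrite !inE => /eqP Dx /eqP Dy.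
    by apply: inj1; rewrite ?inE ?Dx ?Dy //; lia.
  rewrite -sum1_card big_mkcond /=; apply: leq_trans; apply: leq_sum => v _.
  by rewrite inE; case: eqP.
have : (dev D (t + 3) + 2 * #|up D mu| <= 2 * #|~: up D mu| + S1 + 2 * \sum_v (D v == (mu + 1)%R))%N.
  rewrite /dev /S1 -!sum1_card !(big_mkcond [in _]) !big_distrr -!big_split /=.
  apply: leq_sum => v _; rewrite !inE; have := upT v.
  by case: (ltP mu (D v)) => h; case: eqP => h' /=; move: Dv0 h h';
    move: (D v) (mu) (t : int) => a b c; lia.
have := cardsC (up D mu); rewrite card_ord q'E; move: one SE; lia.
Qed.

Lemma dev_max D : lipschitz e D -> exists k : int, (dev D (3 * k) < max_bound n)%N \/
    ((dev D (3 * k) <= max_bound n)%N /\ injective D).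
Proof.
move=> lD; have [v0 [upH dnH]] := median D (leq_trans (isT : (0 < 7)%N) n_gt6).
have [[k E]|[[k E]|[k E]]] : (exists k, D v0 = 3 * k) \/ (exists k, D v0 = 3 * k + 1)
    \/ exists k, D v0 = 3 * k - 1.
  have [h|[h|h]] : (D v0 %% 3)%Z = 0 \/ (D v0 %% 3)%Z = 1 \/ (D v0 %% 3)%Z = 2 by lia.
  - by left; exists (D v0 %/ 3)%Z; lia.
  - by right; left; exists (D v0 %/ 3)%Z; lia.
  - by right; right; exists ((D v0 %/ 3)%Z + 1); lia.
- exists k; left; rewrite -E dev_split.
  have [le1 _] := @up_sum n e tr D (D v0) v0 lD ltac:(by lia).
  have [le2 _] := @dn_sum n e tr D (D v0) v0 lD ltac:(by lia).
  apply: leq_ltn_trans (leq_add le1 le2) _; apply: max_bound_center => //.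
  have dis : [disjoint up D (D v0) & dn D (D v0)].
    by rewrite disjoints_subset; apply/subsetP => v; rewrite !inE; lia.
  have : (#|up D (D v0) :|: dn D (D v0)| < #|[set: 'I_n]|)%N.
    by apply: proper_card; apply/properP; split=> //; exists v0; rewrite // !inE ltxx.
  by rewrite cardsT card_ord cardsU (disjoint_setI0 dis) cards0 subn0.
- exact: dev_max_side E upH dnH.
(* A median 3 k - 1 of [D] is a median 3 (- k) + 1 of [- D]. *)
have [||||k' H] := @dev_max_side (fun v => - D v) v0 (- k).
- exact: lipschitzN.
- by rewrite E; lia.
- by rewrite upN opprK.
- by rewrite dnN opprK.
exists (- k'); have <- : dev (fun v => - D v) (3 * k') = dev D (3 * - k').
  by apply: eq_bigr => v _; lia.
by case: H => [|[? inj]]; [left|right; split=> // x y xy; apply: inj; rewrite xy].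
Qed.

(** The values of [D], without gaps or repetitions, give the positions on the path. Vertices [u],
    [v] with consecutive values are adjacent, since no other edge can leave the set of vertices with
    values up to [D u]. *)
Lemma injective_path D : lipschitz e D -> injective D -> isomorphic e (path_rel n).
Proof.
move=> lD inj; have n_gt0 : (0 < n)%N by lia.
have [sym irr _ _] := tr.
case: (@arg_minP _ int _ (Ordinal n_gt0) xpredT D isT) => v0 _ vmin.
have {}vmin v : D v0 <= D v by apply: vmin.
have lt v : (`|D v - D v0| < n)%N.
  have := @gapless_le n (fun v => `|D v - D v0|.+1)%N setT v; rewrite cardsT card_ord; apply=> //.
  move=> u _; split=> // hu; have := vmin u => vu.
  have [||w wE] := @lipschitz_between n e tr D v0 u (D u - 1) lD; [lia|lia|].
  by exists w; rewrite ?inE // wE; lia.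
exists (fun v => Ordinal (lt v)); split.
  apply: injF_bij => u v /(congr1 val) /= E; apply: inj.
  by have := vmin u; have := vmin v; lia.
have step u v : D v = D u + 1 -> e u v.
  move=> Dv; apply/negPn/negP => ne; suff : D v <= D u by lia.
  apply: (tree_ind (P := fun v => D v <= D u) tr (r := u)) => // x y exy Dx.
  have := lD _ _ exy; case: (ltP (D u) (D y)) => // Dy lxy.
  have xu : x = u by apply: inj; lia.
  have yv : y = v by apply: inj; lia.
  by rewrite xu yv (negbTE ne) in exy.
move=> u v; rewrite /path_rel /=; have := vmin u; have := vmin v => vv vu.
apply/idP/idP => [/orP[]/eqP E|euv].
- by apply: step; lia.
- by rewrite sym; apply: step; lia.
have := lD _ _ euv; have : D u <> D v by move/inj => E; rewrite E irr in euv.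
lia.
Qed.

End Maximum.

(** * The path attains the bound *)

Lemma sum_dist c d : (\sum_(i < c + d.+1) `|i - c| = 'C(c.+1, 2) + 'C(d.+1, 2))%N.
Proof.
elim: d => [|d IH]; last first.
  by rewrite addnS big_ord_recr /= IH (binS2 d.+1); lia.
rewrite addn1 addn0; elim: c => [|c IH]; first by rewrite big_ord_recr big_ord0.
rewrite big_ord_recl /= (binS2 c.+1) -IH addnC; congr addn; last by lia.
by apply: eq_bigr => i _; rewrite /bump /=; lia.
Qed.

Lemma sqr_le_exp3 n : (n * n <= 3 ^ n)%N.
Proof.
case: n => [|[|n]] //; elim: n => // n IH; rewrite expnS.
by apply: leq_trans (leq_mul (leqnn 3) IH); nia.
Qed.

Lemma max_bound_exp3 n : (6 < n)%N -> (max_bound n <= 3 ^ n)%N.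
Proof.
move=> n7; apply: leq_trans (sqr_le_exp3 n).
have [H [M [_ -> HM M2 ->]]] := max_boundE n7.
by have := bin2_double M; have := bin2_double H; nia.
Qed.

(** The shift by M places the multiples of 3 at the positions M + 3 k. Positions M and M + 3 enclose
    the middle of the path, so the others do no better, and both reach the bound. *)
Lemma cdiam_path n (e : rel 'I_n) : (6 < n)%N -> is_tree e -> isomorphic e (path_rel n) ->
  (max_bound n <= cdiam e)%N.
Proof.
move=> n7 tr [f [[g fK gK] fE]]; have [H [M [_ nE HM M2 BE]]] := max_boundE n7.
apply: (cdiam_ge tr (D := fun v => (f v : nat)%:Z - M%:Z)); [lia| |move=> k|exact: max_bound_exp3].
  by move=> u v; rewrite -fE /path_rel; lia.
have -> : dev (fun v => (f v : nat)%:Z - M%:Z) (3 * k)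
        = (\sum_(i < n) `|(i : nat)%:Z - (M%:Z + 3 * k)%R|)%N.
  by rewrite [RHS](reindex f) /=; [apply: eq_bigr => v _; lia | exists g => v _].
have sc (c : nat) : (\sum_(i < n) c = n * c)%N by rewrite sum_nat_const card_ord.
case: (leP k 0) => hk.
  have [d dE] : exists d : nat, 3 * k = - d%:Z by exists `|(3 * k)%R|%N; lia.
  have SM : (\sum_(i < n) `|i - M| = max_bound n)%N.
    rewrite BE (_ : n = M + H.+1.+1)%N; last by lia.
    by rewrite sum_dist (binS2 H.+1); lia.
  (* Moving the point down from M by [d] adds [d] at the H + 1 positions beyond M and saves at most
     [d] at each of the M + 1 others. *)
  have : (\sum_(i < n) `|i - M| + \sum_(i < n) d <=
          \sum_(i < n) `|(i : nat)%:Z - (M%:Z + 3 * k)%R| + (2 * d) * \sum_(i < n) (i < M.+1))%N.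
    rewrite big_distrr -!big_split /=; apply: leq_sum => i _.
    by rewrite dE; case: (ltnP i M.+1); lia.
  rewrite SM sc sum_ltn (minn_idPl _); last by lia.
  by move: (\sum_(i < n) _)%N => S; nia.
have [d dE] : exists d : nat, 3 * k = 3 + d%:Z by exists `|(3 * k - 3)%R|%N; lia.
have SM : (max_bound n <= \sum_(i < n) `|i - (M + 3)|)%N.
  have [H' HE] : exists H', H = H'.+2 by exists (H - 2)%N; lia.
  rewrite BE (_ : n = (M + 3) + H'.+1)%N; last by lia.
  rewrite sum_dist HE addn3 (binS2 H'.+2) (binS2 H'.+1) (binS2 M.+3) (binS2 M.+2) (binS2 M.+1).
  by lia.
have : (\sum_(i < n) `|i - (M + 3)| + 2 * d * \sum_(i < n) (i < M + 3) <=
        \sum_(i < n) `|(i : nat)%:Z - (M%:Z + 3 * k)%R| + \sum_(i < n) d)%N.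
  rewrite big_distrr -!big_split /=; apply: leq_sum => i _.
  by rewrite dE; case: (ltnP i (M + 3)); lia.
rewrite sc sum_ltn (minn_idPl _); last by lia.
by move: SM; move: (\sum_(i < n) _)%N (\sum_(i < n) _)%N => S S'; nia.
Qed.

Lemma isomorphic_dec n (e e' : rel 'I_n) : decidable (isomorphic e e').
Proof.
apply: (@decP _ [exists f : {ffun 'I_n -> 'I_n}, injectiveb f &&
  [forall u, forall v, e' (f u) (f v) == e u v]]).
apply: (iffP existsP) => [[f /andP[/injectiveP inj /forallP fE]]|[f [bij fE]]].
  exists f; split=> [|u v]; first exact: injF_bij.
  by apply/eqP; move/forallP: (fE u).
exists (finfun f); apply/andP; split.
  by apply/injectiveP => u v; rewrite !ffunE; apply: bij_inj.
by apply/forallP => u; apply/forallP => v; rewrite !ffunE fE.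
Qed.

(** On a tree that is not a path no 1-Lipschitz [D] is injective, so [dev_max] is strict for every
    [D] and the diameter is at most the bound minus one. *)
Lemma cdiam_max_iff n (e : rel 'I_n) : (6 < n)%N -> is_tree e ->
  (cdiam e <= max_bound n)%N /\ (cdiam e = max_bound n <-> isomorphic e (path_rel n)).
Proof.
move=> n7 tr; have Bpos : (0 < max_bound n)%N by have [H [M [_ _ _ _ ->]]] := max_boundE n7; lia.
have [iso|niso] := isomorphic_dec e (path_rel n).
  suff dE : cdiam e = max_bound n by rewrite dE.
  apply/eqP; rewrite eqn_leq cdiam_path // andbT; apply: (cdiam_le tr) => D lD.
  by have [k [/ltnW|[]]] := dev_max n7 tr lD; exists k.
suff lt : (cdiam e < max_bound n)%N.
  by split; [exact: ltnW | split=> [E|//]; rewrite E ltnn in lt].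
rewrite -(prednK Bpos) ltnS; apply: (cdiam_le tr) => D lD.
have [k [lt|[_ inj]]] := dev_max n7 tr lD; first by exists k; rewrite -ltnS prednK.
by case: niso; apply: injective_path inj.
Qed.

Local Close Scope ring_scope.

Theorem mainTheorem1 (n : nat) (hn : 7 <= n) :
  (forall e : rel 'I_n, is_tree e ->
     cdiam e <= max_bound n /\ (cdiam e = max_bound n <-> isomorphic e (path_rel n)))
  /\
  (forall e : rel 'I_n, is_tree e ->
     (3 * n)./2 <= cdiam e /\
     (cdiam e = (3 * n)./2 <->
        (isomorphic e (star_rel n) \/
         exists a b : nat, [/\ 1 <= a, 1 <= b, a + b + 2 = n,
                              (a <= b + 4) && (b <= a + 4) & isomorphic e (dstar_rel n a)]))).
Proof.
split=> e tr; first exact: cdiam_max_iff.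
split; last exact: cdiam_min_iff.
by apply: cdiam_lower tr; apply: leq_trans hn.
Qed.
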